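(* Let $\mathcal{M}'_a: z(u,v)=f(u)\,l(v)+g(u)\,e_4$, $u\in I$, $v\in J$, be a meridian surface of type $\mathcal{M}'_a$ in $\mathbb{E}^4_2$ (so $l$ is a unit-speed spacelike curve on $\mathbb{S}^2_1(1)$ and $f'^2-g'^2=-1$). Then $\mathcal{M}'_a$ is quasi-minimal if and only if the curve $l$ has constant curvature $\kappa=a=\mathrm{const}$, $a\neq0$, and the meridian curve $u\mapsto(f(u),g(u))$ is determined by $f'=\varphi(f)$, where $$\varphi(t)=\pm\frac1t\sqrt{(\pm at+c)^2-t^2},\qquad c=\mathrm{const},$$ and $g(u)$ is defined by $g'=\sqrt{f'^2+1}$.
   Context: $\mathbb{E}^4_2$ is $\mathbb{R}^4$ with the inner product $\langle x,y\rangle=x_1y_1+x_2y_2-x_3y_3-x_4y_4$ and standard basis $e_1,e_2,e_3,e_4$. Let $\mathbb{E}^3_1=\mathrm{span}\{e_1,e_2,e_3\}$ and $\mathbb{S}^2_1(1)=\{V\in\mathbb{E}^3_1:\langle V,V\rangle=1\}$. Meridian surface of type $\mathcal{M}'_a$: let $I,J\subset\mathbb{R}$ be intervals, $f,g:I\to\mathbb{R}$ smooth with $f$ nowhere zero, $f'^2-g'^2=-1$ and $g'>0$; let $l:J\to\mathbb{S}^2_1(1)$ be a smooth curve with $\langle l',l'\rangle=1$. The surface is $z(u,v)=f(u)l(v)+g(u)e_4$. Its induced metric is Lorentzian, with orthonormal tangent frame $X=z_u$, $Y=z_v/f=l'$, $\langle X,X\rangle=-1$, $\langle Y,Y\rangle=1$.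 Curvature of $l$ (spherical curvature): put $t=l'$ and let $n$ be the vector field along $l$ (unique up to sign) such that $\{l,t,n\}$ is an orthonormal frame of $\mathbb{E}^3_1$ with $\langle n,n\rangle=-1$; then $\kappa(v)=\langle t'(v),n(v)\rangle$, so that $t'=-\kappa n-l$, $n'=-\kappa t$. For a Lorentz surface with second fundamental form $h$, the mean curvature vector field is $H=\tfrac12\,\mathrm{tr}\,h=\tfrac12\left(h(E_1,E_1)-h(E_2,E_2)\right)$ for any local orthonormal tangent frame with $\langle E_1,E_1\rangle=1$, $\langle E_2,E_2\rangle=-1$. The surface is quasi-minimal if $H$ is lightlike at each point, i.e. $H\neq0$ and $\langle H,H\rangle=0$. ''$f'=\varphi(f)$'' means $f'(u)=\varphi(f(u))$.
   Formalization: The outer sign of φ may vary with u (f' can change sign), and ''determined by f'=φ(f)'' excludes constant f unless φ vanishes identically: e.g. f=1, a=2, c=-1 satisfies f'=φ(f) but is not quasi-minimal. *)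

(* Defs.v *)
From HB Require Import structures.
From mathcomp Require Import all_boot all_order all_algebra.
From mathcomp Require Import all_classical all_reals all_analysis.
Set Implicit Arguments.
Unset Strict Implicit.
Unset Printing Implicit Defensive.
Import Order.TTheory GRing.Theory Num.Theory.
Import numFieldNormedType.Exports.
Local Open Scope classical_set_scope.
Local Open Scope ring_scope.

Definition nondegenerate_interval (R : realType) (I : set R) : Prop :=
  is_interval I /\ exists x y : R, [/\ I x, I y & x < y].

(* Intervals may contain endpoints; as usual, a map is smooth on [A] when it is
   C^infinity on a neighbourhood of each point of [A], so that the two-sided
   derivatives below make sense at every point of [A].  Open [A] gives the
   plain notion. *)
Definition smooth_on (R : realType) (V : normedModType R) (A : set R)
    (f : R -> V) : Prop :=
  forall x, A x -> \forall y \near x, forall k : nat, derivable (derive1n k f) y 1.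

Section PseudoEuclidean.
Variable R : realType.
Implicit Types x y w : 'rV[R]_4.

(* Signature (+,+,-,-); the coordinates x_1, ..., x_4 are indexed by 0, ..., 3. *)
Definition inner x y : R :=
  \sum_(i < 4) (-1) ^+ (2 <= i)%N * x 0 i * y 0 i.

Definition e4 : 'rV[R]_4 := delta_mx 0 ord_max.

Definition E31 : set 'rV[R]_4 := [set x | x 0 ord_max = 0].

Definition S21 : set 'rV[R]_4 := [set x | E31 x /\ inner x x = 1].

Definition lightlike x : Prop := x != 0 /\ inner x x = 0.

End PseudoEuclidean.

Section ParametrizedSurface.
Variables (R : realType) (z : R -> R -> 'rV[R]_4).

Definition du (w : R -> R -> 'rV[R]_4) (u v : R) := derive1 (fun s => w s v) u.
Definition dv (w : R -> R -> 'rV[R]_4) (u v : R) := derive1 (w u) v.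

(* A pair [p] stands for the tangent vector p.1 z_u + p.2 z_v. *)
Definition tangent (u v : R) (p : R * R) : 'rV[R]_4 :=
  p.1 *: du z u v + p.2 *: dv z u v.

Definition orthonormal_frame (u v : R) (p q : R * R) : Prop :=
  [/\ inner (tangent u v p) (tangent u v p) = 1,
      inner (tangent u v q) (tangent u v q) = -1
    & inner (tangent u v p) (tangent u v q) = 0].

(* Projection onto the normal space, when E1, E2 span the tangent plane and
   <E1,E1> = 1, <E2,E2> = -1, <E1,E2> = 0. *)
Definition normal_part (E1 E2 w : 'rV[R]_4) : 'rV[R]_4 :=
  w - inner w E1 *: E1 + inner w E2 *: E2.

(* h(a, b) is the normal part of the flat ambient derivative, i.e. of
   sum_(i, j) a_i b_j z_ij; the frame (p, q) only serves to project. *)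
Definition second_form (u v : R) (p q a b : R * R) : 'rV[R]_4 :=
  normal_part (tangent u v p) (tangent u v q)
    ((a.1 * b.1) *: du (du z) u v + (a.1 * b.2 + a.2 * b.1) *: dv (du z) u v
     + (a.2 * b.2) *: dv (dv z) u v).

Definition mean_curvature (u v : R) (p q : R * R) : 'rV[R]_4 :=
  2^-1 *: (second_form u v p q p p - second_form u v p q q q).

(* The existence of a frame says that z is an immersion with Lorentzian induced
   metric; H does not depend on the frame. *)
Definition quasi_minimal (I J : set R) : Prop :=
  forall u v, I u -> J v ->
    (exists p q, orthonormal_frame u v p q) /\
    (forall p q, orthonormal_frame u v p q ->
       lightlike (mean_curvature u v p q)).

End ParametrizedSurface.

Section MeridianSurface.
Variable R : realType.

Record meridian_surface (I J : set R) (f g : R -> R) (l : R -> 'rV[R]_4) :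
    Prop := MeridianSurface {
  meridian_I : nondegenerate_interval I;
  meridian_J : nondegenerate_interval J;
  smooth_f : smooth_on I f;
  smooth_g : smooth_on I g;
  f_neq0 : forall u, I u -> f u != 0;
  meridian_unit : forall u, I u -> derive1 f u ^+ 2 - derive1 g u ^+ 2 = -1;
  dg_gt0 : forall u, I u -> 0 < derive1 g u;
  smooth_l : smooth_on J l;
  l_S21 : forall v, J v -> S21 (l v);
  l_unit_speed : forall v, J v -> inner (derive1 l v) (derive1 l v) = 1
}.

Definition meridian_param (f g : R -> R) (l : R -> 'rV[R]_4) (u v : R) :
    'rV[R]_4 := f u *: l v + g u *: e4 R.

(* Together with <l,l> = <l',l'> = 1 (which forces <l,l'> = 0 on J), these
   conditions say that {l, l', n} is an orthonormal frame of E^3_1. *)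
Record spherical_normal (J : set R) (l n : R -> 'rV[R]_4) : Prop :=
    SphericalNormal {
  smooth_n : smooth_on J n;
  n_E31 : forall v, J v -> E31 (n v);
  n_unit : forall v, J v -> inner (n v) (n v) = -1;
  n_orth_l : forall v, J v -> inner (n v) (l v) = 0;
  n_orth_t : forall v, J v -> inner (n v) (derive1 l v) = 0
}.

Definition spherical_curvature (l n : R -> 'rV[R]_4) (v : R) : R :=
  inner (derive1 (derive1 l) v) (n v).

(* The inner sign is s = false for +a, s = true for -a. *)
Definition radicand (s : bool) (a c t : R) : R :=
  ((-1) ^+ s * a * t + c) ^+ 2 - t ^+ 2.

Definition phi (r s : bool) (a c t : R) : R :=
  (-1) ^+ r * (t^-1 * Num.sqrt (radicand s a c t)).

(* "f is determined by f' = phi(f)".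
   - The outer sign of the two-valued function phi is taken pointwise: f' may
     change sign, since the meridian may have turning points (f' = 0, f'' != 0).
   - The last clause discards the singular solutions of this equation, namely
     f constant equal to an isolated zero of phi: a constant f is accepted only
     when phi vanishes identically. *)
Definition determined_by_phi (I : set R) (f : R -> R) (s : bool) (a c : R) :
    Prop :=
  [/\ forall u, I u -> 0 <= radicand s a c (f u),
      forall u, I u -> exists r : bool, derive1 f u = phi r s a c (f u)
    & (exists2 u, I u & derive1 f u != 0) \/ (forall t, radicand s a c t = 0)].

End MeridianSurface.

(* Main.v *)
(** In the frame (l, l', n, e4), which is an isometry of E^4_2, the mean
    curvature vector has coordinates
      (-N, 0, -kappa, -f' N / g') / (2 f),   N = g'^2 + f f'',
    so H is lightlike iff kappa <> 0 and N^2 = (kappa g')^2.  Separating the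
    variables u and v, this says that kappa is a nonzero constant a and
    N = b g' with b = a or b = -a, the sign being constant by connectedness.
    Since g' (f g' - b f)' = f' (N - b g'), the equation N = b g' has the first
    integral f g' = b f + c, which squares to f^2 f'^2 = (b f + c)^2 - f^2.
    Conversely the first integral only gives f' (N - b g') = 0; where
    N - b g' <> 0, f is locally constant, hence N - b g' = 1 - b, and by
    continuity N - b g' vanishes identically as soon as f is not constant. *)
Require Import Defs.
From mathcomp Require Import all_boot all_order all_algebra.
From mathcomp Require Import all_classical all_reals all_analysis.
From mathcomp Require Import ring lra.
Import Order.TTheory GRing.Theory Num.Theory.
Import numFieldNormedType.Exports.
Local Open Scope classical_set_scope.
Local Open Scope ring_scope.

(** * One-variable calculus on intervals that may contain their endpoints *)

Section Analysis.
Context {R : realType}.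
Implicit Types (A I : set R) (f g : R -> R).

Lemma smooth_on_is_derive {V : normedModType R} {A} {h : R -> V} {x : R} (k : nat) :
  smooth_on A h -> A x -> is_derive x 1 (derive1n k h) (derive1n k.+1 h x).
Proof.
move=> sh Ax; rewrite derive1nS derive1E; apply: derivableP.
exact: (nbhs_singleton (sh _ Ax)).
Qed.

Lemma is_derive_mx {m n} (M : R -> 'M[R]_(m, n)) (x : R) (dM : 'M[R]_(m, n)) :
  is_derive x 1 M dM <->
  forall i j, is_derive x 1 (fun s => M s i j : R) (dM i j).
Proof.
split=> [[dMx <-] i j|H].
  rewrite derive_mx// mxE; apply: derivableP.
  by move/derivable_mxP : dMx; apply.
have dMx : derivable M x 1 by apply/derivable_mxP => i j; have [] := H i j.
apply: DeriveDef => //; rewrite derive_mx//; apply/matrixP => i j.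
by rewrite mxE; have [_ ->] := H i j.
Qed.

Lemma is_derive_inner (a b : R -> 'rV[R]_4) (x : R) (da db : 'rV[R]_4) :
  is_derive x 1 a da -> is_derive x 1 b db ->
  is_derive x 1 (fun s => inner (a s) (b s)) (inner da (b x) + inner (a x) db).
Proof.
move=> /is_derive_mx ha /is_derive_mx hb; rewrite /inner.
have -> : (fun s => \sum_(i < 4) (-1) ^+ (2 <= i)%N * a s 0 i * b s 0 i) =
  \sum_(i < 4) (fun s => (-1) ^+ (2 <= i)%N * a s 0 i * b s 0 i).
  by apply/funext => s; rewrite fct_sumE.
rewrite -big_split/=; apply: is_derive_sum => i.
have hai := ha 0 i; have hbi := hb 0 i.
have -> : (fun s => (-1) ^+ (2 <= i)%N * a s 0 i * b s 0 i) =
  (-1) ^+ (2 <= i)%N *: ((fun s => a s 0 i) * (fun s => b s 0 i)).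
  by apply/funext => s; rewrite /= -mulrA.
by apply: is_derive_eq; rewrite /GRing.scale/=; ring.
Qed.

Lemma is_derive_scalel {m n} f (w : 'M[R]_(m, n)) (x df : R) :
  is_derive x 1 f df -> is_derive x 1 (fun s => f s *: w) (df *: w).
Proof.
move=> hf; apply/is_derive_mx => i j; rewrite !mxE.
under eq_fun do rewrite mxE mulrC.
by apply: is_derive_eq; rewrite /GRing.scale/= mulrC.
Qed.

Lemma is_derive_continuous f (x df : R) :
  is_derive x 1 f df -> {for x, continuous f}.
Proof.
by move=> [+ _] => /derivable1_diffP/differentiable_continuous.
Qed.

Lemma is_derive_derive1 {V : normedModType R} (h : R -> V) (x : R) dh :
  is_derive x 1 h dh -> derive1 h x = dh.
Proof. by move=> [_ <-]; rewrite derive1E. Qed.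

(* The interval may have [x] as an endpoint, while the derivative is two-sided. *)
Lemma is_derive_interval_cst I f (x c df : R) :
  nondegenerate_interval I -> I x ->
  (\forall y \near x, I y -> f y = c) -> is_derive x 1 f df -> df = 0.
Proof.
move=> [Iitv [a [b [Ia Ib ab]]]] Ix fc [dfx dfE].
have fx : f x = c := nbhs_singleton fc Ix.
apply/eqP; apply: contraT => df0.
have {}dfx : h^-1 *: (f (h *: 1 + x) - f x) @[h --> 0^'] --> df.
  by rewrite -dfE; exact: dfx.
(* If [df] were nonzero, the difference quotient would be nonzero for every small nonzero increment;
   an increment that keeps the point in [I] makes it zero, a contradiction. *)
have := cvgr_neq0 _ dfx df0.
rewrite near_withinE => -[e /= e0 He].
case: fc => e' /= e'0 Hc.
pose d := Num.min e e' / 2.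
have d0 : 0 < d by rewrite divr_gt0// lt_min e0.
have [de de'] : d < e /\ d < e'.
  have : d < Num.min e e' by rewrite /d ltr_pdivrMr// ltr_pMr ?ltr1n// lt_min e0.
  by rewrite lt_min => /andP[].
suff [h [h0 hd Ixh]] : exists h, [/\ h != 0, `|h| <= d & I (h + x)].
  have := He h; rewrite /ball_/= sub0r normrN => /(_ (le_lt_trans hd de) h0).
  rewrite fx [h%:A]mulr1 Hc ?subrr ?scaler0 ?eqxx//.
  by rewrite /ball_/= opprD addrCA subrr addr0 normrN (le_lt_trans hd).
(* The increment points towards [b] when [x < b] and towards [a] otherwise, and is cut off so as not
   to overshoot that point. *)
have [xb|bx] := ltP x b.
  exists (Num.min d (b - x)); have hp : 0 < Num.min d (b - x).
    by rewrite lt_min d0 subr_gt0.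
  split; [by rewrite gt_eqF| by rewrite gtr0_norm// ge_min lexx|].
  apply: (Iitv x b Ix Ib); rewrite lerDr (ltW hp)/= -lerBrDr.
  by rewrite ge_min lexx orbT.
have ax : a < x by exact: lt_le_trans ab bx.
exists (- Num.min d (x - a)); have hp : 0 < Num.min d (x - a).
  by rewrite lt_min d0 subr_gt0.
split; [by rewrite oppr_eq0 gt_eqF
       | by rewrite normrN gtr0_norm// ge_min lexx|].
apply: (Iitv a x Ia Ix); rewrite addrC lerBrDr -lerBrDl ge_min lexx orbT/=.
by rewrite gerBl ltW.
Qed.

Lemma is_derive0_interval_cst I f (x y : R) :
  is_interval I -> (forall z, I z -> is_derive z 1 f 0) -> I x -> I y ->
  f x = f y.
Proof.
move=> Iitv df0; wlog xy : x y / x <= y.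
  by move=> H Ix Iy; case: (leP x y) => [|/ltW] xy; [|apply/esym]; exact: H.
move=> Ix Iy; have xyI z : z \in `[x, y] -> I z.
  by rewrite in_itv/=; exact: Iitv.
have [||c _] := @MVT_segment _ f (fun=> 0) x y xy.
- by move=> z /subset_itv_oo_cc/xyI/df0.
- by apply: derivable_within_continuous => z /xyI/df0[].
- by rewrite mul0r => /subr0_eq.
Qed.

(** By the intermediate value theorem [f] attains the midpoint of [f x] and [f y]. If these differed
    they would be [p] and [q], and their midpoint is neither. *)
Lemma two_valued_interval_cst I f (p q x y : R) :
  is_interval I -> (forall z, I z -> {for z, continuous f}) ->
  (forall z, I z -> f z = p \/ f z = q) -> I x -> I y -> f x = f y.
Proof.
move=> Iitv cf pq; wlog xy : x y / x <= y.
  by move=> H Ix Iy; case: (leP x y) => [|/ltW] xy; [|apply/esym]; exact: H.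
move=> Ix Iy; have xyI z : z \in `[x, y] -> I z.
  by rewrite in_itv/=; exact: Iitv.
have cxy : {within `[x, y], continuous f}.
  by apply: continuous_in_subspaceT => z /[!inE] /xyI/cf.
have [] := @IVT _ f x y ((f x + f y) / 2) xy cxy.
  by rewrite ge_min le_max; case: (leP (f x) (f y)) => ?; apply/andP; split;
    apply/orP; [left|right|right|left]; lra.
move=> c /xyI Ic; case: (pq _ Ic) (pq _ Ix) (pq _ Iy) => -> [] -> [] ->; lra.
Qed.

(** The quotient [f / g] is continuous with values 1 and -1, so connectedness makes one sign valid
    on all of [I]. *)
Lemma sqr_eq_interval_sign I f g :
  is_interval I -> (forall z, I z -> {for z, continuous f}) ->
  (forall z, I z -> {for z, continuous g}) -> (forall z, I z -> g z != 0) ->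
  (forall z, I z -> f z ^+ 2 = g z ^+ 2) ->
  exists s : bool, forall z, I z -> f z = (-1) ^+ s * g z.
Proof.
move=> Iitv cf cg g0 fg.
have [[x Ix]|I0] := pselect (exists x, I x); last first.
  by exists false => z Iz; case: I0; exists z.
have fg1 z : I z -> f z / g z = 1 \/ f z / g z = -1.
  move=> Iz; have /eqP := fg _ Iz; rewrite eqf_sqr => /orP[]/eqP ->.
    by left; rewrite divff ?g0.
  by right; rewrite mulNr divff ?g0.
have cst z : I z -> f z / g z = f x / g x.
  move=> Iz; apply: (@two_valued_interval_cst I (fun z => f z / g z) 1 (-1)) => //.
  by move=> t It; apply: cvgM; [exact: cf|apply: cvgV; [exact: g0|exact: cg]].
have [s Hs] : exists s : bool, f x / g x = (-1) ^+ s.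
  by case: (fg1 _ Ix) => ->; [exists false|exists true].
by exists s => z Iz; rewrite -Hs -(cst _ Iz) divfK ?g0.
Qed.

End Analysis.

(** * Linear algebra of the inner product, its isometries and coordinates *)

Section Inner.
Context {R : realType}.
Implicit Types (x y w : 'rV[R]_4) (A : 'M[R]_4).

Definition gram : 'M[R]_4 := diag_mx (\row_i (-1) ^+ (2 <= i)%N).

Lemma inner_mx x y : inner x y = (x *m gram *m y^T) 0 0.
Proof.
rewrite /inner mxE; apply: eq_bigr => i _; rewrite mul_mx_diag !mxE.
by rewrite (mulrC (x 0 i)).
Qed.

Lemma gramK : gram *m gram = 1%:M.
Proof.
rewrite /gram mulmx_diag; apply/matrixP => i j; rewrite !mxE.
by case: eqP => // _; rewrite -expr2 sqrr_sign.
Qed.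

Lemma innerC x y : inner x y = inner y x.
Proof. by rewrite /inner; apply: eq_bigr => i _; rewrite mulrAC. Qed.

Lemma innerDl x y w : inner (x + y) w = inner x w + inner y w.
Proof.
by rewrite /inner -big_split; apply: eq_bigr => i _; rewrite mxE mulrDr mulrDl.
Qed.

Lemma innerZl a x w : inner (a *: x) w = a * inner x w.
Proof.
by rewrite /inner mulr_sumr; apply: eq_bigr => i _; rewrite mxE; ring.
Qed.

Lemma inner_e4 x : inner x (e4 R) = - x 0 ord_max.
Proof.
rewrite /inner (bigD1 ord_max)//= big1 => [|i i3]; last first.
  by rewrite mxE (negbTE i3) andbF mulr0.
by rewrite /e4 mxE !eqxx/= mulr1 addr0 expr1 mulN1r.
Qed.

(** Row vectors are multiplied on the right: [x *m A] is the vector whose coordinates in the frame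
    formed by the rows of [A] are the entries of [x]. *)
Definition isometry A : Prop := A *m gram *m A^T = gram.

Lemma isometryP A :
  isometry A <-> forall i j, inner (row i A) (row j A) = gram i j.
Proof.
have E i j : inner (row i A) (row j A) = (A *m gram *m A^T) i j.
  by rewrite inner_mx -!row_mul !mxE; apply: eq_bigr => k _; rewrite !mxE.
by split=> [iA i j|iA]; [rewrite E iA | apply/matrixP => i j; rewrite -E].
Qed.

Lemma isometry_unitmx {A} : isometry A -> A \in unitmx.
Proof.
move=> iA; have : A *m (gram *m A^T *m gram) = 1%:M.
  by rewrite 2!mulmxA iA gramK.
by case/mulmx1_unit.
Qed.

Lemma isometry_inner A x y : isometry A -> inner (x *m A) (y *m A) = inner x y.
Proof.
by move=> iA; rewrite !inner_mx trmx_mul !mulmxA -(mulmxA x) -(mulmxA x) iA.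
Qed.

(** Since [gram] is its own inverse, [gram *m A^T *m gram] is a right inverse of [A], hence a left
    inverse too. Inserting it after [x] produces the products with the rows, and the last [gram]
    supplies their signs. *)
Lemma isometry_expand A x :
  isometry A -> x = (\row_i (gram i i * inner x (row i A))) *m A.
Proof.
move=> iA; have : A *m (gram *m A^T *m gram) = 1%:M.
  by rewrite 2!mulmxA iA gramK.
move=> /mulmx1C AK; rewrite -[LHS]mulmx1 -AK !mulmxA; congr (_ *m A).
apply/rowP => i; rewrite /gram mul_mx_diag !mxE eqxx mulrC; congr (_ * _).
by rewrite inner_mx !mxE; apply: eq_bigr => k _; rewrite !mxE.
Qed.

Lemma isometry_lightlike A x : isometry A -> lightlike (x *m A) <-> lightlike x.
Proof.
move=> iA; rewrite /lightlike isometry_inner//.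
have -> // : (x *m A != 0) = (x != 0).
congr (~~ _); apply/eqP/eqP => [xA|->]; last by rewrite mul0mx.
by rewrite -(mulmxK (isometry_unitmx iA) x) xA mul0mx.
Qed.

(** Allows the trace of the second fundamental form to be taken before projecting, so that only one
    projection is computed. *)
Lemma normal_partB E1 E2 x y :
  normal_part E1 E2 x - normal_part E1 E2 y = normal_part E1 E2 (x - y).
Proof.
have innerBl w : inner (x - y) w = inner x w - inner y w.
  by rewrite -scaleN1r innerDl innerZl mulN1r.
apply/matrixP => i j; rewrite /normal_part !innerBl.
by rewrite !mxE; ring.
Qed.

Lemma isometry_normal_part A E1 E2 x : isometry A ->
  normal_part (E1 *m A) (E2 *m A) (x *m A) = normal_part E1 E2 x *m A.
Proof.
by move=> iA; rewrite /normal_part !isometry_inner// mulmxDl mulmxBl -!scalemxAl.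
Qed.

Definition row4 (a b c d : R) : 'rV[R]_4 := \row_(i < 4) [:: a; b; c; d]`_i.

Lemma row4D a b c d a' b' c' d' :
  row4 a b c d + row4 a' b' c' d' = row4 (a + a') (b + b') (c + c') (d + d').
Proof. by apply/rowP; case=> -[|[|[|[|//]]]] Hi; rewrite !mxE. Qed.

Lemma row4Z k a b c d :
  k *: row4 a b c d = row4 (k * a) (k * b) (k * c) (k * d).
Proof. by apply/rowP; case=> -[|[|[|[|//]]]] Hi; rewrite !mxE. Qed.

Lemma inner_row4 a b c d a' b' c' d' :
  inner (row4 a b c d) (row4 a' b' c' d') = a * a' + b * b' - c * c' - d * d'.
Proof.
rewrite /inner !big_ord_recr big_ord0 /= !mxE /=; ring.
Qed.

Lemma row4_eq0 a b c d :
  (row4 a b c d == 0) = [&& a == 0, b == 0, c == 0 & d == 0].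
Proof.
apply/eqP/and4P => [/rowP H|[/eqP-> /eqP-> /eqP-> /eqP->]].
  have Hi (i : 'I_4) : [:: a; b; c; d]`_i = 0 by have := H i; rewrite !mxE.
  by split; apply/eqP; [exact: (Hi (@Ordinal 4 0 _))|exact: (Hi (@Ordinal 4 1 _))
   |exact: (Hi (@Ordinal 4 2 _))|exact: (Hi (@Ordinal 4 3 _))].
by apply/rowP; case=> -[|[|[|[|//]]]] Hi; rewrite !mxE.
Qed.

Lemma row4_mulmx a b c d A :
  row4 a b c d *m A = a *: row (@Ordinal 4 0 isT) A + b *: row (@Ordinal 4 1 isT) A
    + c *: row (@Ordinal 4 2 isT) A + d *: row (@Ordinal 4 3 isT) A.
Proof.
rewrite mulmx_sum_row !big_ord_recr big_ord0 /= add0r !mxE/=.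
by do !congr (_ + _); congr (_ *: row _ _); apply: val_inj.
Qed.

End Inner.

(** * Pointwise computation of the mean curvature vector in an arbitrary frame *)

Section MeridianAlgebra.
Context {R : realType}.

(** With rows (a, b) and (c, d), the hypotheses are the row relations of a matrix preserving a
    Lorentz form up to order of the axes; the column relations then hold as well. Squaring b d = a c
    gives a^2 = d^2, from which the rest follows. *)
Lemma lorentz_transpose (a b c d : R) :
  b ^+ 2 - a ^+ 2 = 1 -> d ^+ 2 - c ^+ 2 = -1 -> b * d - a * c = 0 ->
  [/\ a ^+ 2 - c ^+ 2 = -1, b ^+ 2 - d ^+ 2 = 1 & a * b = c * d].
Proof.
move=> h1 h2 h3.
have ad : a ^+ 2 = d ^+ 2.
  have : (b * d) ^+ 2 = (a * c) ^+ 2 by congr (_ ^+ 2); lra.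
  rewrite !exprMn; have -> : b ^+ 2 = 1 + a ^+ 2 by lra.
  have -> : c ^+ 2 = 1 + d ^+ 2 by lra.
  lra.
have bc : b ^+ 2 = c ^+ 2 by lra.
split; [lra|lra|].
have c0 : c != 0.
  apply/eqP => c0; move: h2; rewrite c0 expr0n/= => h2.
  have := sqr_ge0 d; lra.
apply: (mulIf c0).
have -> : a * b * c = b * (a * c) by ring.
have -> : a * c = b * d by lra.
have -> : b * (b * d) = b ^+ 2 * d by ring.
by rewrite bc; ring.
Qed.

(* Evaluated at (u, v): r = f, F = f', G = g', F2 = f'', G2 = g'', k = kappa;
   the coordinates are those in the frame (l, l', n, e4). *)
Lemma meridian_normal_part (r F G F2 G2 k p1 p2 q1 q2 : R) :
  let zuu := row4 F2 0 0 G2 in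
  let zuv := row4 0 F 0 0 in
  let zvv := r *: row4 (-1) 0 (- k) 0 in
  let E1 := row4 (p1 * F) (p2 * r) 0 (p1 * G) in
  let E2 := row4 (q1 * F) (q2 * r) 0 (q1 * G) in
  let N := G ^+ 2 + r * F2 in
  r != 0 -> G != 0 -> F * F2 = G * G2 -> F ^+ 2 - G ^+ 2 = -1 ->
  [/\ inner E1 E1 = 1, inner E2 E2 = -1 & inner E1 E2 = 0] ->
  2^-1 *: normal_part E1 E2
    (((p1 * p1) *: zuu + (p1 * p2 + p2 * p1) *: zuv + (p2 * p2) *: zvv)
     - ((q1 * q1) *: zuu + (q1 * q2 + q2 * q1) *: zuv + (q2 * q2) *: zvv)) =
  (2 * r)^-1 *: row4 (- N) 0 (- k) (- (F * N / G)).
Proof.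
move=> zuu zuv zvv E1 E2 N r0 G0 FG FG1.
have EE x y x' y' : inner (row4 (x * F) (y * r) 0 (x * G))
    (row4 (x' * F) (y' * r) 0 (x' * G)) = (y * r) * (y' * r) - x * x'.
  rewrite inner_row4.
  transitivity ((y * r) * (y' * r) + x * x' * (F ^+ 2 - G ^+ 2)); first by ring.
  by rewrite FG1 mulrN1.
rewrite !EE -!expr2 => -[/lorentz_transpose H /H{}H /H[e1 e2 e3]].
(* The column relations eliminate the frame coefficients: the trace is [- zuu + r^-2 *: zvv] for
   every orthonormal frame. *)
set W := (X in normal_part _ _ X).
have -> : W = row4 (- F2 - r^-1) 0 (- k / r) (- G2).
  have e3' : p1 * p2 - q1 * q2 = 0.
    by apply/eqP; rewrite subr_eq0; apply/eqP/(mulIf r0); rewrite -!mulrA.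
  have e2' : p2 ^+ 2 - q2 ^+ 2 = r^-1 ^+ 2.
    apply: (mulIf (expf_neq0 2 r0)); rewrite -exprMn mulVf// expr1n -[RHS]e2.
    ring.
  rewrite /W /zuu /zuv /zvv -[- (_ + _)]scaleN1r !(row4Z, row4D); congr row4.
  - have -> : - F2 - r^-1 = (p1 ^+ 2 - q1 ^+ 2) * F2 - (p2 ^+ 2 - q2 ^+ 2) * r.
      by rewrite e1 e2'; field.
    by ring.
  - by transitivity (2 * F * (p1 * p2 - q1 * q2)); [ring|rewrite e3' mulr0].
  - have -> : - k / r = - (p2 ^+ 2 - q2 ^+ 2) * (r * k).
      by rewrite e2'; field.
    by ring.
  - have -> : - G2 = (p1 ^+ 2 - q1 ^+ 2) * G2 by rewrite e1; ring.
    by ring.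
have EW x y : inner (row4 (- F2 - r^-1) 0 (- k / r) (- G2)) (row4 (x * F) (y * r) 0 (x * G))
    = - (x * F / r).
  rewrite inner_row4.
  have -> : (- F2 - r^-1) * (x * F) + 0 * (y * r) - - k / r * 0 - - G2 * (x * G)
    = - (x * F / r) - x * (F * F2 - G * G2) by ring.
  by rewrite FG subrr mulr0 subr0.
rewrite /normal_part !EW -scaleNr !(row4Z, row4D).
have G2E : G2 = F * F2 / G by apply: (mulIf G0); rewrite divfK// FG mulrC.
have GG : G ^+ 2 = F ^+ 2 + 1 by lra.
rewrite /N; congr row4.
- transitivity (2^-1 * (- F2 - r^-1 + (p1 ^+ 2 - q1 ^+ 2) * F ^+ 2 / r)).
    by ring.
  by rewrite e1 GG; field.
- transitivity (2^-1 * (F / r) * (p1 * (p2 * r) - q1 * (q2 * r))); first by ring.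
  by rewrite e3 subrr !mulr0.
- by field.
- transitivity (2^-1 * (- G2 + (p1 ^+ 2 - q1 ^+ 2) * F * G / r)); first by ring.
  by rewrite e1 G2E; field; rewrite G0 r0.
Qed.

End MeridianAlgebra.

(** * The moving frame (l, l', n, e4) and its Frenet equation *)

Section MeridianFrame.
Context {R : realType} {I J : set R} {f g : R -> R} {l n : R -> 'rV[R]_4}.
Context (hM : meridian_surface I J f g l) (hn : spherical_normal J l n).
Implicit Types u v : R.

Let t := derive1 l.

Let l_derive v : J v -> is_derive v 1 l (t v).
Proof. exact: (smooth_on_is_derive 0 (smooth_l hM)). Qed.

Let t_derive v : J v -> is_derive v 1 t (derive1 t v).
Proof. exact: (smooth_on_is_derive 1 (smooth_l hM)). Qed.

(** Product rule for an inner product that is constant along [J]; it yields the relations among l,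
    t, t' and e4 below. *)
Let inner_derive (a b : R -> 'rV[R]_4) v (c : R) da db :
  J v -> (forall w, J w -> inner (a w) (b w) = c) ->
  is_derive v 1 a da -> is_derive v 1 b db ->
  inner da (b v) + inner (a v) db = 0.
Proof.
move=> Jv abc ha hb.
apply: (@is_derive_interval_cst _ J (fun s => inner (a s) (b s)) v c) => //.
- exact: meridian_J hM.
- by near=> y; exact: abc.
- exact: is_derive_inner.
Unshelve. all: by end_near. Qed.

Let innerll v : J v -> inner (l v) (l v) = 1.
Proof. by move=> /(l_S21 hM)[]. Qed.

Let innerle v : J v -> inner (l v) (e4 R) = 0.
Proof. by move=> /(l_S21 hM)[le _]; rewrite inner_e4 le oppr0. Qed.

Let innertt v : J v -> inner (t v) (t v) = 1.
Proof. exact: (l_unit_speed hM). Qed.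

Let innerlt v : J v -> inner (l v) (t v) = 0.
Proof.
move=> Jv; have := inner_derive _ _ _ _ _ _ Jv innerll (l_derive _ Jv) (l_derive _ Jv).
by rewrite (innerC (t v)); lra.
Qed.

Let innerte v : J v -> inner (t v) (e4 R) = 0.
Proof.
move=> Jv; have := inner_derive _ _ _ _ _ _ Jv innerle (l_derive _ Jv) (is_derive_cst (e4 R) v 1).
by rewrite (innerC (l v)) -(scale0r 0) innerZl mul0r addr0.
Qed.

Let innert'l v : J v -> inner (derive1 t v) (l v) = -1.
Proof.
move=> Jv; have := inner_derive _ _ _ _ _ _ Jv innerlt (l_derive _ Jv) (t_derive _ Jv).
by rewrite innertt// (innerC (l v)); lra.
Qed.

Let innert't v : J v -> inner (derive1 t v) (t v) = 0.
Proof.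
move=> Jv; have := inner_derive _ _ _ _ _ _ Jv innertt (t_derive _ Jv) (t_derive _ Jv).
by rewrite (innerC (t v)); lra.
Qed.

Let innert'e v : J v -> inner (derive1 t v) (e4 R) = 0.
Proof.
move=> Jv; have := inner_derive _ _ _ _ _ _ Jv innerte (t_derive _ Jv) (is_derive_cst (e4 R) v 1).
by rewrite (innerC (t v)) -(scale0r 0) innerZl mul0r addr0.
Qed.

Let innerne v : J v -> inner (n v) (e4 R) = 0.
Proof. by move=> /(n_E31 hn) ne; rewrite inner_e4 ne oppr0. Qed.

Definition frame_mx v : 'M[R]_4 :=
  \matrix_(i < 4) [:: l v; derive1 l v; n v; e4 R]`_i.

Lemma frame_mx_isometry v : J v -> isometry (frame_mx v).
Proof.
move=> Jv; have nn := n_unit hn Jv; have nl := n_orth_l hn Jv.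
have nt := n_orth_t hn Jv; have ne := innerne _ Jv.
have ee : inner (e4 R) (e4 R) = -1 by rewrite inner_e4 mxE !eqxx.
apply/isometryP => i j; rewrite !rowK !mxE.
case: i => -[|[|[|[|//]]]] Hi; case: j => -[|[|[|[|//]]]] Hj //=; rewrite -?val_eqE/=
  ?(expr0, expr1, mulr0n, mulr1n)//
  ?(innerll _ Jv, innertt _ Jv, innerlt _ Jv, innerle _ Jv, innerte _ Jv, ee, nn, nl, nt, ne)//;
  by rewrite innerC ?(innerlt _ Jv, innerle _ Jv, innerte _ Jv, nl, nt, ne).
Qed.

Lemma frame_mx_row4 v a b c d :
  row4 a b c d *m frame_mx v = a *: l v + b *: t v + c *: n v + d *: e4 R.
Proof. by rewrite row4_mulmx !rowK. Qed.

(** The Frenet equation t' = -kappa n - l, obtained by expanding t' in the frame. Differentiating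
    <l, t> = 0 gives the coefficient of l; the sign before kappa comes from <n, n> = -1. *)
Lemma derive_t_frame v : J v ->
  derive1 t v = row4 (-1) 0 (- spherical_curvature l n v) 0 *m frame_mx v.
Proof.
move=> Jv; rewrite [LHS](isometry_expand _ _ (frame_mx_isometry _ Jv)).
congr (_ *m _); apply/rowP => i; rewrite !mxE rowK eqxx mulr1n.
case: i => -[|[|[|[|//]]]] Hi /=.
- by rewrite expr0 mul1r innert'l.
- by rewrite expr0 mul1r innert't.
- by rewrite expr1 mulN1r.
- by rewrite innert'e// mulr0.
Qed.

(** * Partial derivatives of the parametrization *)

Let z := meridian_param f g l.

Let f_derive u : I u -> is_derive u 1 f (derive1 f u).
Proof. exact: (smooth_on_is_derive 0 (smooth_f hM)). Qed.

Let g_derive u : I u -> is_derive u 1 g (derive1 g u).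
Proof. exact: (smooth_on_is_derive 0 (smooth_g hM)). Qed.

(** Derivability is assumed instead of [I u] because the second derivative at an endpoint of [I]
    needs this formula on a full neighbourhood, including points outside [I]. *)
Lemma du_meridian u v : derivable f u 1 -> derivable g u 1 ->
  du z u v = derive1 f u *: l v + derive1 g u *: e4 R.
Proof.
move=> df dg; apply: is_derive_derive1; rewrite !derive1E.
by apply: is_deriveD; apply: is_derive_scalel; exact: derivableP.
Qed.

Lemma dv_meridian u v : derivable l v 1 -> dv z u v = f u *: t v.
Proof.
move=> dl; apply: is_derive_derive1; rewrite /t derive1E.
apply: is_derive_eq (addr0 _); apply: is_deriveD.
by apply: is_deriveZ; exact: derivableP.
Qed.

Let near_derivable A (h : R -> R) u (k : nat) : smooth_on A h -> A u ->
  \forall s \near u, derivable (derive1n k h) s 1.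
Proof. by move=> sh Au; apply: filterS (sh _ Au) => s; apply. Qed.

Lemma duu_meridian u v : I u ->
  du (du z) u v = derive1 (derive1 f) u *: l v + derive1 (derive1 g) u *: e4 R.
Proof.
move=> Iu; apply: is_derive_derive1.
apply: (@near_eq_is_derive _ _ _ (fun s => derive1 f s *: l v + derive1 g s *: e4 R)).
  apply: filterS2 (near_derivable _ _ _ 0%N (smooth_f hM) Iu)
    (near_derivable _ _ _ 0%N (smooth_g hM) Iu) => s df dg.
  by apply/esym; exact: du_meridian.
apply: is_deriveD; apply: is_derive_scalel.
  exact: (smooth_on_is_derive 1 (smooth_f hM)).
exact: (smooth_on_is_derive 1 (smooth_g hM)).
Qed.

Lemma duv_meridian u v : I u -> J v -> dv (du z) u v = derive1 f u *: t v.
Proof.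
move=> Iu Jv; apply: is_derive_derive1.
have -> : du z u = fun w => derive1 f u *: l w + derive1 g u *: e4 R.
  by apply/funext => w; apply: du_meridian; [case: (f_derive _ Iu)|case: (g_derive _ Iu)].
apply: is_derive_eq (addr0 _); apply: is_deriveD.
by apply: is_deriveZ; exact: l_derive.
Qed.

Lemma dvv_meridian u v : J v -> dv (dv z) u v = f u *: derive1 t v.
Proof.
move=> Jv; apply: is_derive_derive1.
apply: (@near_eq_is_derive _ _ _ (fun w => f u *: t w)); last first.
  by apply: is_deriveZ; exact: t_derive.
have : \forall w \near v, derivable l w 1.
  by apply: filterS (smooth_l hM Jv) => w /(_ 0%N).
by apply: filterS => w dl; rewrite dv_meridian.
Qed.


Lemma tangent_meridian u v p : I u -> J v ->
  tangent z u v p = row4 (p.1 * derive1 f u) (p.2 * f u) 0 (p.1 * derive1 g u)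
                      *m frame_mx v.
Proof.
move=> Iu Jv; have [df _] := f_derive _ Iu; have [dg _] := g_derive _ Iu.
have [dl _] := l_derive _ Jv; rewrite /tangent du_meridian// dv_meridian//.
by rewrite frame_mx_row4 scale0r addr0 scalerDr !scalerA addrAC.
Qed.

(** Half the derivative of f'^2 - g'^2, which is constant on [I]. *)
Lemma ddf_ddg u : I u ->
  derive1 f u * derive1 (derive1 f) u = derive1 g u * derive1 (derive1 g) u.
Proof.
move=> Iu; have h1 := smooth_on_is_derive 1 (smooth_f hM) Iu.
have h2 := smooth_on_is_derive 1 (smooth_g hM) Iu.
have sqrB_derive (a b : R -> R) da db : is_derive u 1 a da ->
    is_derive u 1 b db -> is_derive u 1 (a ^+ 2 - b ^+ 2) (2 * (a u * da - b u * db)).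
  by move=> ha hb; apply: is_derive_eq; rewrite /GRing.scale/=; ring.
have /(is_derive_interval_cst _ _ _ (-1) _ (meridian_I hM) Iu) H :=
  sqrB_derive _ _ _ _ h1 h2.
apply/subr0_eq/eqP; rewrite -(@mulrI_eq0 _ 2) ?H//.
  by near=> y => Iy; exact: (meridian_unit hM).
by apply/mulfI; rewrite pnatr_eq0.
Unshelve. all: by end_near. Qed.

(** * The mean curvature vector and its causal character *)

Definition tension u :=
  derive1 g u ^+ 2 + f u * derive1 (derive1 f) u.

Let kappa := spherical_curvature l n.

(** The normal projection commutes with the isometry [frame_mx v], so the computation moves to frame
    coordinates, where [meridian_normal_part] applies with [tension u] as its N. *)
Lemma mean_curvature_meridian u v p q : I u -> J v ->
  orthonormal_frame z u v p q ->
  mean_curvature z u v p q =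
    ((2 * f u)^-1 *: row4 (- tension u) 0 (- kappa v)
                          (- (derive1 f u * tension u / derive1 g u)))
      *m frame_mx v.
Proof.
move=> Iu Jv; have iA := frame_mx_isometry _ Jv.
rewrite /orthonormal_frame /mean_curvature /second_form normal_partB.
rewrite !tangent_meridian// !isometry_inner//.
rewrite duu_meridian// duv_meridian// dvv_meridian// derive_t_frame//.
move=> pq; have lm := frame_mx_row4 v.
have -> : derive1 (derive1 f) u *: l v + derive1 (derive1 g) u *: e4 R =
    row4 (derive1 (derive1 f) u) 0 0 (derive1 (derive1 g) u) *m frame_mx v.
  by rewrite lm !scale0r !addr0.
have -> : derive1 f u *: t v = row4 0 (derive1 f u) 0 0 *m frame_mx v.
  by rewrite lm !scale0r !addr0 add0r.
rewrite !scalemxAl -!mulmxDl -mulmxBl isometry_normal_part// scalemxAl.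
congr (_ *m _); case: p q pq => [p1 p2] [q1 q2] /= pq.
have G0 : derive1 g u != 0 by rewrite lt0r_neq0//; exact: (dg_gt0 hM).
have f0 : f u != 0 by exact: (f_neq0 hM).
exact: (@meridian_normal_part R _ _ _ _ _ (kappa v) _ _ _ _
  f0 G0 (ddf_ddg _ Iu) (meridian_unit hM Iu) pq).
Qed.

Lemma meridian_frame u v : I u -> J v ->
  orthonormal_frame z u v (0, (f u)^-1) (1, 0).
Proof.
move=> Iu Jv; have iA := frame_mx_isometry _ Jv; have f0 := f_neq0 hM Iu.
have := meridian_unit hM Iu.
rewrite /orthonormal_frame !tangent_meridian// !isometry_inner// !inner_row4/=.
move=> H; split; rewrite ?mulVf//; [ring| |ring].
by rewrite -H; ring.
Qed.

(** Up to the factor 1 / (4 f^2), <H, H> is N^2 - kappa^2 - f'^2 N^2 / g'^2. Substituting f'^2 =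
    g'^2 - 1 turns this into (N^2 - kappa^2 g'^2) / g'^2. *)
Lemma quasi_minimal_meridian :
  quasi_minimal z I J <->
  forall u v, I u -> J v ->
    kappa v != 0 /\ tension u ^+ 2 = (kappa v * derive1 g u) ^+ 2.
Proof.
have key u v p q : I u -> J v -> orthonormal_frame z u v p q ->
    lightlike (mean_curvature z u v p q) <->
    (kappa v != 0 /\ tension u ^+ 2 = (kappa v * derive1 g u) ^+ 2).
  move=> Iu Jv pq; rewrite mean_curvature_meridian//.
  rewrite isometry_lightlike; last exact: frame_mx_isometry.
  have := meridian_unit hM Iu; have := f_neq0 hM Iu; have := dg_gt0 hM Iu.
  set F := derive1 f u; set G := derive1 g u; set N := tension u.
  set k := kappa v; set r := f u => /lt0r_neq0 G0 r0 FG.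
  have c0 : (2 * r)^-1 != 0 by rewrite invr_eq0 mulf_neq0// pnatr_eq0.
  rewrite /lightlike scaler_eq0 (negbTE c0)/= row4_eq0 eqxx !oppr_eq0/=.
  rewrite innerZl innerC innerZl inner_row4.
  have E : - N * - N + 0 * 0 - - k * - k - - (F * N / G) * - (F * N / G) =
      (N ^+ 2 - (k * G) ^+ 2) / G ^+ 2.
    transitivity (N ^+ 2 - k ^+ 2 - F ^+ 2 * N ^+ 2 / G ^+ 2); first by field.
    have -> : F ^+ 2 = G ^+ 2 - 1 by lra.
    by field.
  rewrite E; split=> [[H0 /eqP]|[k0 H]].
    rewrite !mulf_eq0 (negbTE c0) invr_eq0 expf_eq0/= (negbTE G0) orbF subr_eq0.
    (* If kappa vanished, so would N, and then H itself. *)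
    move=> /eqP NK; split=> //; apply/eqP => k0.
    have N0 : N = 0 by apply/eqP; rewrite -sqrf_eq0 NK k0 mul0r expr0n.
    by move: H0; rewrite N0 k0 mulr0 mul0r eqxx.
  by rewrite H subrr mul0r !mulr0 (negbTE k0) andbF.
split=> [H u v Iu Jv|H u v Iu Jv].
  have [_ /(_ _ _ (meridian_frame _ _ Iu Jv))] := H _ _ Iu Jv.
  by rewrite key//; exact: meridian_frame.
split; first by exists (0, (f u)^-1), (1, 0); exact: meridian_frame.
by move=> p q pq; rewrite key//; exact: H.
Qed.


(** * Continuity and the first integral of the meridian equation *)

Lemma continuous_curvature v : J v -> {for v, continuous kappa}.
Proof.
move=> Jv; apply: is_derive_continuous; apply: is_derive_inner.
  exact: (smooth_on_is_derive 2 (smooth_l hM)).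
exact: (smooth_on_is_derive 0 (smooth_n hn)).
Qed.

Let df_derive u : I u -> is_derive u 1 (derive1 f) (derive1 (derive1 f) u).
Proof. exact: (smooth_on_is_derive 1 (smooth_f hM)). Qed.

Let dg_derive u : I u -> is_derive u 1 (derive1 g) (derive1 (derive1 g) u).
Proof. exact: (smooth_on_is_derive 1 (smooth_g hM)). Qed.

Let dg_neq0 u : I u -> derive1 g u != 0.
Proof. by move=> Iu; rewrite lt0r_neq0//; exact: (dg_gt0 hM). Qed.

(** The unit-speed relation times f^2; it translates between the first integral and [radicand]. *)
Let fdg_sqr u : I u -> (f u * derive1 g u) ^+ 2 = (f u * derive1 f u) ^+ 2 + f u ^+ 2.
Proof.
move=> Iu; have := meridian_unit hM Iu; rewrite !exprMn => FG.
have -> : derive1 g u ^+ 2 = derive1 f u ^+ 2 + 1 by lra.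
ring.
Qed.

Let continuous_f u : I u -> {for u, continuous f}.
Proof. by move=> Iu; exact: is_derive_continuous (f_derive _ Iu). Qed.

Let continuous_dg u : I u -> {for u, continuous (derive1 g)}.
Proof. by move=> Iu; exact: is_derive_continuous (dg_derive _ Iu). Qed.

Let continuous_lin (h : R -> R) u (k c : R) :
  {for u, continuous h} -> {for u, continuous (fun s => k * h s + c)}.
Proof.
by move=> hc; apply: cvgD; [apply: cvgM; [exact: cvg_cst|exact: hc]|exact: cvg_cst].
Qed.

Lemma continuous_tension u : I u -> {for u, continuous tension}.
Proof.
move=> Iu; apply: cvgD.
  by apply: cvgM; exact: continuous_dg.
apply: cvgM; first exact: continuous_f.
exact: is_derive_continuous (smooth_on_is_derive 2 (smooth_f hM) Iu).
Qed.

Lemma first_integral_derive (b : R) u : I u ->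
  is_derive u 1 (fun s => f s * derive1 g s - b * f s)
    (derive1 f u * (tension u - b * derive1 g u) / derive1 g u).
Proof.
move=> Iu; have hf := f_derive _ Iu; have hg := dg_derive _ Iu.
have G0 := dg_neq0 _ Iu; have FG := ddf_ddg _ Iu.
have -> : derive1 f u * (tension u - b * derive1 g u) / derive1 g u =
    f u * derive1 (derive1 g) u + derive1 g u * derive1 f u - b * derive1 f u.
  apply: (mulIf G0); rewrite divfK// /tension.
  transitivity (derive1 f u * (derive1 g u ^+ 2 - b * derive1 g u) +
    f u * (derive1 f u * derive1 (derive1 f) u)); first by ring.
  by rewrite FG; ring.
apply: is_deriveB.
Qed.

(** Where f' = 0, unit speed and g' > 0 force g' = 1; since f' vanishes on [I] near [u], also f'' =
    0, which leaves N = g'^2. *)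
Lemma dvanish_tension u : I u ->
  (\forall y \near u, I y -> derive1 f y = 0) -> derive1 g u = 1 /\ tension u = 1.
Proof.
move=> Iu F0; have Fu : derive1 f u = 0 := nbhs_singleton F0 Iu.
have G1 : derive1 g u = 1.
  have /eqP := meridian_unit hM Iu; rewrite Fu expr0n/= sub0r eqr_opp sqrf_eq1.
  have := dg_gt0 hM Iu => /[swap] /orP[]/eqP -> //.
  by rewrite ltr0N1.
split=> //; rewrite /tension G1 expr1n.
rewrite (is_derive_interval_cst _ _ _ _ _ (meridian_I hM) Iu F0 (df_derive _ Iu)).
by rewrite mulr0 addr0.
Qed.

Lemma tension_first_integral (b : R) :
  (forall u, I u -> tension u = b * derive1 g u) ->
  exists c, forall u, I u -> f u * derive1 g u = b * f u + c.
Proof.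
move=> Nb; have [Iitv [u0 [_ [Iu0 _ _]]]] := meridian_I hM.
exists (f u0 * derive1 g u0 - b * f u0) => u Iu.
have D0 w : I w -> is_derive w 1 (fun s => f s * derive1 g s - b * f s) 0.
  move=> Iw; apply: is_derive_eq (first_integral_derive b _ Iw) _.
  by rewrite Nb// subrr mulr0 mul0r.
rewrite -(is_derive0_interval_cst _ _ _ _ Iitv D0 Iu Iu0) /=; ring.
Qed.

(** The continuous function N - b g' takes only the values 0 and 1 - b, so it is constant on [I]; at
    [u1], where f' is nonzero, it is 0. *)
Lemma first_integral_tension (b c u1 : R) :
  (forall u, I u -> f u * derive1 g u = b * f u + c) ->
  I u1 -> derive1 f u1 != 0 ->
  forall u, I u -> tension u = b * derive1 g u.
Proof.
move=> fint Iu1 F1 u Iu; have [Iitv _] := meridian_I hM.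
have FD0 w : I w -> derive1 f w * (tension w - b * derive1 g w) = 0.
  move=> Iw; have := first_integral_derive b _ Iw.
  have cst : \forall y \near w, I y -> f y * derive1 g y - b * f y = c.
    by near=> y => Iy; rewrite fint//; ring.
  move=> /(is_derive_interval_cst _ _ _ _ _ (meridian_I hM) Iw cst)/eqP.
  by rewrite mulf_eq0 invr_eq0 (negbTE (dg_neq0 _ Iw)) orbF => /eqP.
have D_continuous w : I w ->
    {for w, continuous (fun s => tension s - b * derive1 g s)}.
  move=> Iw; apply: cvgB; first exact: continuous_tension.
  by apply: cvgM; [exact: cvg_cst|exact: continuous_dg].
have D01 w : I w -> tension w - b * derive1 g w = 0 \/
    tension w - b * derive1 g w = 1 - b.
  move=> Iw; have [->|Dw] := eqVneq (tension w - b * derive1 g w) 0; first by left.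
  right; suff [-> ->] : derive1 g w = 1 /\ tension w = 1 by rewrite mulr1.
  apply: dvanish_tension => //.
  (* By continuity N - b g' stays nonzero near [w], so the product relation [FD0] makes f' vanish
     there. *)
  apply: filterS (cvgr_neq0 _ (D_continuous _ Iw) Dw) => y Dy Iy; have /eqP := FD0 _ Iy.
  by rewrite mulf_eq0 (negbTE Dy) orbF => /eqP.
apply: subr0_eq.
rewrite (two_valued_interval_cst _ _ _ _ _ _ Iitv D_continuous D01 Iu Iu1).
by have /eqP := FD0 _ Iu1; rewrite mulf_eq0 (negbTE F1) => /eqP.
Unshelve. all: by end_near. Qed.

(** * The two implications *)

Lemma quasi_minimal_curvature : quasi_minimal z I J ->
  exists a, [/\ a != 0, forall v, J v -> kappa v = a &
    exists s : bool, forall u, I u -> tension u = (-1) ^+ s * a * derive1 g u].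
Proof.
move=> /quasi_minimal_meridian qm.
have [Iitv [u0 [_ [Iu0 _ _]]]] := meridian_I hM.
have [Jitv [v0 [_ [Jv0 _ _]]]] := meridian_J hM.
exists (kappa v0); have [a0 _] := qm _ _ Iu0 Jv0; split=> // [v Jv|].
  (* With u fixed at [u0], the equation N^2 = (kappa g')^2 determines kappa^2, because g' is
     nonzero. *)
  apply: (two_valued_interval_cst J kappa (kappa v0) (- kappa v0)) => //.
    exact: continuous_curvature.
  move=> w Jw; have [_ Nw] := qm _ _ Iu0 Jw; have [_ Nv0] := qm _ _ Iu0 Jv0.
  have /eqP : (kappa w * derive1 g u0) ^+ 2 = (kappa v0 * derive1 g u0) ^+ 2.
    by rewrite -Nw.
  rewrite !exprMn => /eqP/(mulIf (expf_neq0 2 (dg_neq0 _ Iu0)))/eqP.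
  by rewrite eqf_sqr => /orP[]/eqP; [left|right].
(* Now v is fixed at [v0], and the sign relating N to a g' is uniform on [I]. *)
have [||||s Ns] := sqr_eq_interval_sign I tension
    (fun u => kappa v0 * derive1 g u) Iitv.
- exact: continuous_tension.
- by move=> u Iu; apply: cvgM; [exact: cvg_cst|exact: continuous_dg].
- by move=> u Iu; rewrite mulf_neq0// dg_neq0.
- by move=> u Iu; have [] := qm _ _ Iu Jv0.
- by exists s => u Iu; rewrite Ns// mulrA.
Qed.

Lemma first_integral_determined (s : bool) (a : R) :
  (forall u, I u -> tension u = (-1) ^+ s * a * derive1 g u) ->
  exists c, determined_by_phi I f s a c.
Proof.
move=> Ns; have [c fint] := tension_first_integral _ Ns.
have radE u : I u -> radicand s a c (f u) = (f u * derive1 f u) ^+ 2.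
  by move=> Iu; rewrite /radicand -fint// fdg_sqr// addrK.
exists c; split=> [u Iu|u Iu|]; first by rewrite radE// sqr_ge0.
  have f0 := f_neq0 hM Iu.
  (* The square root is |f f'|, so the outer sign of [phi] must be the sign of f f'. *)
  exists (f u * derive1 f u < 0); rewrite /phi radE// sqrtr_sqr.
  case: ltP => [fF|fF]; [rewrite ltr0_norm//|rewrite ger0_norm//].
    by rewrite expr1 mulN1r mulrN opprK mulKf.
  by rewrite expr0 mul1r mulKf.
have [[u Iu F0]|F0] := pselect (exists2 u, I u & derive1 f u != 0).
  by left; exists u.
(* If f' vanishes throughout, then g' = N = 1, so the signed constant is 1 and c = 0: the radicand
   is t^2 - t^2. *)
right=> t0; have [_ [u0 [_ [Iu0 _ _]]]] := meridian_I hM.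
have [G1 N1] : derive1 g u0 = 1 /\ tension u0 = 1.
  apply: dvanish_tension => //; near=> y => Iy.
  by apply/eqP; apply: contra_notT F0 => Fy; exists y.
have sa : (-1) ^+ s * a = 1 by have := Ns _ Iu0; rewrite G1 N1 mulr1.
have c0 : c = 0 by have := fint _ Iu0; rewrite G1 sa; lra.
by rewrite /radicand sa c0 mul1r addr0 subrr.
Unshelve. all: by end_near. Qed.

(** The equation for f' recovers the first integral only up to a global sign, hence the squares in
    the conclusion. *)
Lemma determined_tension (s : bool) (a c : R) : determined_by_phi I f s a c ->
  forall u, I u -> tension u ^+ 2 = (a * derive1 g u) ^+ 2.
Proof.
move=> [rad_ge0 dfE dfN0] u Iu; have [Iitv _] := meridian_I hM.
have radE w : I w -> (f w * derive1 f w) ^+ 2 = radicand s a c (f w).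
  move=> Iw; have [r ->] := dfE _ Iw; have f0 := f_neq0 hM Iw.
  by rewrite /phi mulrCA exprMn sqrr_sign mul1r mulVKf// sqr_sqrtr// rad_ge0.
case: dfN0 => [[u1 Iu1 F1]|rad0]; last first.
  have [-> ->] : derive1 g u = 1 /\ tension u = 1.
    apply: dvanish_tension => //; near=> y => Iy; apply/eqP.
    have /eqP := radE _ Iy; rewrite rad0 sqrf_eq0 mulf_eq0.
    by rewrite (negbTE (f_neq0 hM Iy)).
  (* A radicand vanishing at 0, 1 and -1 has c^2 = 0 and a^2 = 1, which matches g' = N = 1. *)
  have := rad0 0; have := rad0 1; have := rad0 (-1).
  have : ((-1) ^+ s * a) ^+ 2 = a ^+ 2 by rewrite exprMn sqrr_sign mul1r.
  by rewrite /radicand; move: ((-1) ^+ s * a) => b; lra.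
have [||||e He] := sqr_eq_interval_sign I
  (fun w => (-1) ^+ s * a * f w + c) (fun w => f w * derive1 g w) Iitv.
- by move=> w Iw; apply: continuous_lin; exact: continuous_f.
- by move=> w Iw; apply: cvgM; [exact: continuous_f|exact: continuous_dg].
- by move=> w Iw; rewrite mulf_neq0// ?dg_neq0//; exact: (f_neq0 hM).
- by move=> w Iw; rewrite fdg_sqr// radE// /radicand subrK.
(* The sign [e] is absorbed into both constants of the first integral. *)
have fint w : I w -> f w * derive1 g w =
    (-1) ^+ e * (-1) ^+ s * a * f w + (-1) ^+ e * c.
  move=> Iw; rewrite -[LHS](signrMK e) -He// mulrDr !mulrA//.
rewrite (first_integral_tension _ _ _ fint Iu1 F1 _ Iu).
by rewrite !exprMn !sqrr_sign !mul1r.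
Unshelve. all: by end_near. Qed.

End MeridianFrame.

Theorem theorem5 (R : realType) (I J : set R) (f g : R -> R)
    (l n : R -> 'rV[R]_4)
    (hM : meridian_surface I J f g l)
    (hn : spherical_normal J l n) :
  quasi_minimal (meridian_param f g l) I J <->
  (exists a : R,
     [/\ a != 0,
         forall v, J v -> spherical_curvature l n v = a,
         exists (s : bool) (c : R), determined_by_phi I f s a c
       & forall u, I u -> derive1 g u = Num.sqrt (derive1 f u ^+ 2 + 1)]).
Proof.
split=> [/(quasi_minimal_curvature hM hn)[a [a0 ka [s Ns]]]|
  [a [a0 ka [s [c fphi]] _]]].
  exists a; split=> // [|u Iu].
    by exists s; exact: (first_integral_determined hM).
  have -> : derive1 f u ^+ 2 + 1 = derive1 g u ^+ 2.
    by have := meridian_unit hM Iu; lra.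
  by rewrite sqrtr_sqr ger0_norm// ltW//; exact: (dg_gt0 hM).
apply/(quasi_minimal_meridian hM hn) => u v Iu Jv; rewrite ka//; split=> //.
exact: (determined_tension hM _ _ _ fphi).
Qed.
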